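(* Let $t\neq 0,\pm1,\pm2$ be a cubic rational number, so $t^2-4=-3b^2$ with $b\in\mathbb Q$, $b\neq0$, and let $a_0=t$, $a_1=\frac{-t+3b}{2}$, $a_2=\frac{-t-3b}{2}$. Then the sets $\Pi_0(a_0),\Pi_0(a_1),\Pi_0(a_2)$ are mutually disjoint, and for any three different indices $k_1,k_2,k_3$ from $\{0,1,2\}$ $$\Pi_1(a_{k_1})=\Pi_0(a_{k_2})\cup\Pi_0(a_{k_3}).$$ Moreover $$\Pi_j(a_0)=\Pi_j(a_1)=\Pi_j(a_2)\quad\text{for } j\ge2 .$$ Here $\Pi_j(a)=\Pi_j(a,3)$.
   Context: For rational $a$ put $D_a=\begin{pmatrix}0&-1\\1&a\end{pmatrix}$. For rational $a\neq0,\pm1,\pm2$, $\Pi(a)$ is the set of primes $p\ge5$ not dividing the denominator of $a$ (here the fixed prime is $r=3$, which is removed). For $p\in\Pi(a)$ the index $\chi(a,p)$ is the smallest integer $k\ge1$ with $D_a^k\equiv I\pmod p$. For $j\ge0$, $\Pi_j(a,3)=\{p\in\Pi(a): 3^j\,\|\,\chi(a,p)\}$ (exact power of $3$ dividing the index). A rational $t$ is cubic if $t^2-4=-3b^2$ for some rational $b\neq0$; $a_1,a_2$ are called the associate values of $t$. *)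

(* Defs.v *)
From mathcomp Require Import all_boot all_order all_algebra all_fingroup.
From mathcomp Require Import boolp classical_sets.

Set Implicit Arguments.
Unset Strict Implicit.
Unset Printing Implicit Defensive.

Import Order.TTheory GRing.Theory Num.Theory.

Local Open Scope classical_set_scope.
Local Open Scope ring_scope.

Definition Dmx (a : rat) : 'M[rat]_2 :=
  \matrix_(i < 2, j < 2) nth 0 (nth [::] [:: [:: 0; -1]; [:: 1; a]] i) j.

(* Entrywise congruence modulo p.  numq is the numerator in lowest terms, so
   p %| numq x says that x lies in p Z_(p). *)
Definition mxcongr (p : nat) (A B : 'M[rat]_2) : bool :=
  [forall i, forall j, (p %| `|numq (A i j - B i j)|)%N].

(* Besides the primes dividing the denominator, 2 and the fixed prime r = 3 are
   excluded; Pi_ below is Pi_j(a, 3). *)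
Definition in_Pi (a : rat) (p : nat) : bool :=
  [&& prime p, (5 <= p)%N & ~~ (p %| `|denq a|)%N].

Lemma intF_eq0 (p : nat) (m : int) : prime p ->
  ((m%:~R : 'F_p) == 0) = (p %| `|m|)%N.
Proof.
move=> pp.
have h n : ((n%:R : 'F_p) == 0) = (p %| n)%N.
  by rewrite (dvdn_pcharf (pchar_Fp pp)).
by case: m => n; rewrite ?NegzE ?mulrNz ?oppr_eq0 -pmulrn h ?abszN.
Qed.

Lemma chi_ex (a : rat) (p : nat) :
  exists k, in_Pi a p ==> (0 < k)%N && mxcongr p (Dmx a ^+ k) 1.
Proof.
case: (boolP (in_Pi a p)) => [/and3P[pp _ pd]|_]; last by exists 0%N.
pose n := numq a; pose d := denq a.
pose M : 'M[int]_2 :=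
  \matrix_(i < 2, j < 2) nth 0 (nth [::] [:: [:: 0; - d]; [:: d; n]] i) j.
have d0 : (d%:~R : rat) != 0 by rewrite intr_eq0 denq_eq0.
have dF : (d%:~R : 'F_p) != 0 by rewrite intF_eq0.
have MD : map_mx intr M = (d%:~R : rat) *: Dmx a.
  apply/matrixP=> i j; rewrite !mxE.
  case: i => [[|[|//]] ?] /=; case: j => [[|[|//]] ?] /=.
  - by rewrite mulr0.
  - by rewrite mulrN1 mulrNz.
  - by rewrite mulr1.
  - by rewrite mulrC -numqE.
pose A : 'M['F_p]_2 := (d%:~R : 'F_p)^-1 *: map_mx intr M.
have Au : A \is a GRing.unit.
  rewrite unitmxE unitfE detZ mulf_neq0 //.
    by rewrite expf_neq0 // invr_eq0.
  rewrite (expand_det_row _ ord0) !big_ord_recl big_ord0 /cofactor.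
  rewrite !det_mx11 !mxE /= mul0r add0r addr0 rmorphN /= expr1 mulN1r mulrNN.
  by rewrite mulf_neq0.
pose u : {unit 'M['F_p]_2} := Sub A Au.
exists #[u]%g; apply/andP; split; first exact: order_gt0.
set k := #[u]%g.
have Ak : A ^+ k = 1.
  have := congr1 val (expg_order u).
  by rewrite FinRing.val_unitX FinRing.val_unit1.
have MF : map_mx intr (M ^+ k) = ((d ^+ k)%:~R : 'F_p) *: 1 :> 'M_2.
  rewrite rmorphXn /= -[map_mx _ M](scalerK (invr_neq0 dF)) -/A invrK.
  by rewrite exprZn Ak rmorphXn.
have MQ : map_mx intr (M ^+ k) = ((d ^+ k)%:~R : rat) *: Dmx a ^+ k.
  by rewrite rmorphXn /= MD exprZn rmorphXn.
apply/forallP=> i; apply/forallP=> j.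
set x := (_ - _).
pose m := (M ^+ k) i j - d ^+ k * (i == j)%:R.
have xE : (d ^+ k)%:~R * x = m%:~R.
  have /matrixP/(_ i j) := MQ; rewrite !mxE => MQij.
  by rewrite /x /m mulrBr rmorphB /= MQij !mxE rmorphM /= !rmorph_nat.
have pm : (p %| `|m|)%N.
  have /matrixP/(_ i j) := MF; rewrite !mxE => MFij.
  rewrite -intF_eq0 // /m rmorphB /= MFij rmorphM /= !rmorph_nat.
  by rewrite subrr.
have nE : d ^+ k * numq x = m * denq x.
  apply/eqP; rewrite -(eqr_int rat) !intrM numqE mulrA xE; exact: eqxx.
have : (p %| absz (d ^+ k * numq x)%R)%N by rewrite nE abszM dvdn_mulr.
by rewrite abszM abszX Euclid_dvdM // Euclid_dvdX // (negPf pd).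
Qed.

(* The guard in chi_ex only makes chi total: its value is 0 when
   p is not in Pi(a). *)
Definition chi (a : rat) (p : nat) : nat := ex_minn (chi_ex a p).

Definition Pi_ (j : nat) (a : rat) : set nat :=
  [set p | [&& in_Pi a p, (3 ^ j %| chi a p)%N
             & ~~ (3 ^ j.+1 %| chi a p)%N]].

Definition associates (t b : rat) : 3.-tuple rat :=
  [tuple t; (- t + 3 * b) / 2; (- t - 3 * b) / 2].

(* Main.v *)
Require Import Defs.
From mathcomp Require Import all_boot all_order all_algebra all_fingroup cyclic.
From mathcomp Require Import boolp classical_sets.
From mathcomp Require Import ring zify.
Import Order.TTheory GRing.Theory Num.Theory.
Set Implicit Arguments.
Unset Strict Implicit.
Unset Printing Implicit Defensive.

(** Fix a prime p >= 5 and work over F_p.  Since D_a has characteristic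
    polynomial X^2 - a X + 1, its eigenvalues for a = t are
    lambda = (t + b sqrt(-3)) / 2 and 1 / lambda; the cubic condition is exactly
    what makes lambda live in F_p[sqrt(-3)] with norm 1.  Multiplying lambda by
    a primitive cube root of unity omega gives (a_1 + b_1 sqrt(-3)) / 2 and
    (a_2 + b_2 sqrt(-3)) / 2 for suitable b_1, b_2, so the three indices are,
    up to factors prime to 3, the orders of lambda, lambda omega and
    lambda omega^2.

    The norm-1 elements of F_p[sqrt(-3)] form an abelian group, represented here
    by 2 x 2 matrices of determinant 1, in which the only cube roots of 1 are
    the powers of omega ([cube_root1]).  In such a group the 3-adic valuations
    of the orders of lambda, lambda omega, lambda omega^2 obey three rules: if
    one is 0 the other two are 1 ([logn3_twist0]); if one is 1 then one of the
    three is 0 ([logn3_twist1]); if one is at least 2 then all three agree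
    ([logn3_twist2]).  These rules are the proposition, read one prime at a time.

    Two points need care.  When p divides b, D_t is not semisimple modulo p, and
    its order is p times that of lambda; as p <> 3, the 3-adic valuation is not
    affected ([logn3_order_companion2]).  And the sets Pi(a_i) must coincide:
    t^2 - 4 = - 3 b^2 forces b to be p-integral as soon as t is
    ([reduces_cubic]), and the pairs (a_i, b_i) are obtained from each other by
    linear maps whose only denominator is 2 ([in_Pi_associates]). *)

(** * Orders of an element twisted by an element of order 3 *)

Section Twist.
Local Open Scope group_scope.
Variables (gT : finGroupType) (g w : gT).
Hypotheses (cgw : commute g w) (ow : #[w] = 3%N).

Lemma twist_commute i j : commute (g * w ^+ i) (w ^+ j).
Proof.
apply: commuteX; apply: commute_sym.
by apply: commuteM; [apply: commute_sym | apply: commuteX].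
Qed.

Lemma twistE i j : exists2 c, g * w ^+ j = g * w ^+ i * w ^+ c
   & (i == j %[mod 3]) = (3 %| c).
Proof.
exists (j + 2 * i).
  rewrite -mulgA -expgD; congr (_ * _); apply/eqP.
  rewrite eq_expg_mod_order ow; apply/eqP; lia.
apply/idP/idP; lia.
Qed.

Lemma twist_cube i j : (g * w ^+ i) ^+ 3 = (g * w ^+ j) ^+ 3.
Proof.
have w3 k : (w ^+ k) ^+ 3 = 1.
  by rewrite -expgM mulnC expgM -ow expg_order expg1n.
by rewrite !expgMn ?w3 //; apply: commuteX.
Qed.

(** If 3 does not divide the order of one twist, passing to another twist
    multiplies by an element of order 3, of coprime order. *)
Lemma logn3_twist0 i j : logn 3 #[g * w ^+ i] = 0%N -> ~~ (i == j %[mod 3]) ->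
  logn 3 #[g * w ^+ j] = 1%N.
Proof.
move=> v0; have [c -> ->] := twistE i j => nc.
have co3 : coprime 3 c by rewrite prime_coprime.
have owc : #[w ^+ c] = 3 by rewrite orderXgcd ow (eqP co3).
have co : coprime #[g * w ^+ i] 3.
  by rewrite coprime_sym prime_coprime // -(expn1 3) pfactor_dvdn ?v0.
rewrite orderM ?owc //; last exact: twist_commute.
by rewrite lognM // v0.
Qed.

(** All twists have the same cube, and cubing divides the order by 3 as soon as
    3 divides it; the hypothesis makes the order of the cube divisible by 3, hence
    3 divides the order of every twist. *)
Lemma logn3_twist2 i j : 1 < logn 3 #[g * w ^+ i] ->
  logn 3 #[g * w ^+ j] = logn 3 #[g * w ^+ i].
Proof.
move=> v2; have d9 : 3 ^ 2 %| #[g * w ^+ i] by rewrite pfactor_dvdn.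
have d3 : 3 %| #[g * w ^+ i] by apply: dvdn_trans d9.
have o3 : #[(g * w ^+ i) ^+ 3] = #[g * w ^+ i] %/ 3 by rewrite orderXdiv.
have d3' : 3 %| #[g * w ^+ j].
  apply: dvdn_trans (orderXdvd _ 3); rewrite (twist_cube j i) o3.
  by rewrite dvdn_divRL // dvdn_mull.
rewrite -(divnK d3) -(divnK d3') -o3 (twist_cube i j) orderXdiv //.
Qed.

(** Let y have order 3 m with m prime to 3.  Then y^m is a cube root of 1, hence
    a power of w, which a suitable further twist cancels; the twisted element
    then has order dividing m. *)
Lemma logn3_twist1 i :
  (forall k, (g * w ^+ i) ^+ k ^+ 3 = 1 -> (g * w ^+ i) ^+ k \in <[w]>) ->
  logn 3 #[g * w ^+ i] = 1%N -> exists j, logn 3 #[g * w ^+ j] = 0%N.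
Proof.
set y := g * w ^+ i => H v1.
have d3 : 3 %| #[y] by rewrite -(expn1 3) pfactor_dvdn ?v1.
pose m := #[y] %/ 3.
have m3 : ~~ (3 %| m).
  by rewrite dvdn_divRL // (_ : 3 * 3 = 3 ^ 2)%N ?pfactor_dvdn ?v1.
have /cycleP[c yc] : y ^+ m \in <[w]>.
  by apply: H; rewrite -expgM divnK // expg_order.
(* With y ^+ m = w ^+ c, twisting by w ^+ e kills the m-th power when
   c + e m = 0 mod 3; e = 2 c m is a solution because m^2 = 1 mod 3. *)
exists (i + 2 * c * m).
rewrite expgD mulgA -/y.
suff: (y * w ^+ (2 * c * m)) ^+ m == 1.
  rewrite -order_dvdn => dm; apply/eqP; rewrite lognE -leqn0 leqNgt.
  apply: contra m3; case: ifP => // /and3P[_ _ d] _; exact: dvdn_trans d dm.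
rewrite expgMn; last exact: twist_commute.
rewrite yc -expgM -expgD -order_dvdn ow.
have : m * m = 1 %[mod 3].
  have := ltn_pmod m (isT : 0 < 3); rewrite -modnMm; move: m3; rewrite /dvdn.
  by case: (m %% 3) => [|[|[|]]].
nia.
Qed.
End Twist.

Local Open Scope ring_scope.

(** * Explicit 2 x 2 matrices *)

Definition mx2 (R : nzRingType) (a b c d : R) : 'M[R]_2 :=
  \matrix_(i < 2, j < 2) nth 0 (nth [::] [:: [:: a; b]; [:: c; d]] i) j.

Lemma mx2_eta (R : nzRingType) (M : 'M[R]_2) :
  M = mx2 (M 0 0) (M 0 1) (M 1 0) (M 1 1).
Proof.
apply/matrixP=> i j; rewrite mxE.
by case: i => [[|[|//]] ?] /=; case: j => [[|[|//]] ?] /=; congr (M _ _);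
   apply: val_inj.
Qed.

Lemma mx2_inj (R : nzRingType) (a b c d a' b' c' d' : R) :
  mx2 a b c d = mx2 a' b' c' d' -> [/\ a = a', b = b', c = c' & d = d'].
Proof.
move=> /matrixP E.
by split; [have := E 0 0 | have := E 0 1 | have := E 1 0 | have := E 1 1];
   rewrite !mxE.
Qed.

Lemma mul_mx2 (R : nzRingType) (a b c d a' b' c' d' : R) :
  mx2 a b c d * mx2 a' b' c' d' =
  mx2 (a * a' + b * c') (a * b' + b * d') (c * a' + d * c') (c * b' + d * d').
Proof.
apply/matrixP=> i j; rewrite !mxE !big_ord_recl big_ord0 !mxE addr0.
by case: i => [[|[|//]] ?] /=; case: j => [[|[|//]] ?] /=.
Qed.

Lemma add_mx2 (R : nzRingType) (a b c d a' b' c' d' : R) :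
  mx2 a b c d + mx2 a' b' c' d' = mx2 (a + a') (b + b') (c + c') (d + d').
Proof.
apply/matrixP=> i j; rewrite !mxE.
by case: i => [[|[|//]] ?] /=; case: j => [[|[|//]] ?] /=.
Qed.

Lemma scale_mx2 (R : nzRingType) (k a b c d : R) :
  k *: mx2 a b c d = mx2 (k * a) (k * b) (k * c) (k * d).
Proof.
apply/matrixP=> i j; rewrite !mxE.
by case: i => [[|[|//]] ?] /=; case: j => [[|[|//]] ?] /=.
Qed.

Lemma mx2_1 (R : nzRingType) : 1 = mx2 1 0 0 1 :> 'M[R]_2.
Proof. by rewrite [LHS]mx2_eta !mxE. Qed.

Lemma mx2_0 (R : nzRingType) : 0 = mx2 0 0 0 0 :> 'M[R]_2.
Proof. by rewrite [LHS]mx2_eta !mxE. Qed.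

Lemma det_mx2 (R : comNzRingType) (a b c d : R) :
  \det (mx2 a b c d) = a * d - b * c.
Proof.
rewrite (expand_det_row _ ord0) !big_ord_recl big_ord0 /cofactor.
rewrite !det_mx11 !mxE /= expr0 expr1; ring.
Qed.

(** The remainder of X^k modulo X^2 - c X + 1 depends on c only.  It therefore
    transfers relations between powers from one matrix annihilated by this
    polynomial to another. *)
Lemma quadratic_pow (R : comNzRingType) (n : nat) (c : R) (k : nat) :
  exists u v : R, forall M : 'M[R]_n.+1,
    M ^+ 2 = c *: M - 1 -> M ^+ k = u *: M + v *: 1.
Proof.
elim: k => [|k [u [v IH]]].
  by exists 0, 1 => M _; rewrite expr0 scale0r add0r scale1r.
exists (u * c + v), (- u) => M M2.
rewrite exprSr (IH M M2) mulrDl -!scalerAl mul1r -expr2 M2.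
by rewrite scalerBr scalerDl scalerA scaleNr addrAC.
Qed.

(** * Norm-1 elements of F[sqrt(-3)] in characteristic at least 5 *)

Section Field.
Variables (F : finFieldType) (p : nat).
Hypotheses (pF : p \in [pchar F]) (p5 : (5 <= p)%N).

(** Total on matrices; the default value 1 is taken at singular ones. *)
Definition gl (M : 'M[F]_2) : {unit 'M[F]_2} :=
  insubd (1%g : {unit 'M[F]_2}) M.

Lemma glK M : \det M = 1 -> val (gl M) = M.
Proof. by move=> dM; rewrite insubdK // -topredE /= unitmxE dM unitr1. Qed.

Lemma dvdn_order_gl M k : \det M = 1 -> (#[gl M]%g %| k)%N = (M ^+ k == 1).
Proof.
move=> dM; rewrite order_dvdn -val_eqE FinRing.val_unitX FinRing.val_unit1.
by rewrite glK.
Qed.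

Lemma small_neq0 n : (0 < n < 5)%N -> n%:R != 0 :> F.
Proof.
move=> n5; rewrite -(dvdn_pcharf pF); apply/negP => /dvdn_leq; lia.
Qed.

Definition companion2 (c : F) : 'M[F]_2 := mx2 0 (-1) 1 c.
(** Multiplication by (c + e sqrt(-3)) / 2 on F[sqrt(-3)], in the basis
    (1, sqrt(-3)). *)
Definition eisenstein (c e : F) : 'M[F]_2 :=
  mx2 (c / 2) (- 3 * e / 2) (e / 2) (c / 2).

Let n2 : 2 != 0 :> F := small_neq0 (n := 2) isT.
Let n4 : 4 != 0 :> F := small_neq0 (n := 4) isT.
Let n3 : 3 != 0 :> F := small_neq0 (n := 3) isT.

Lemma det_companion2 c : \det (companion2 c) = 1.
Proof. by rewrite det_mx2; ring. Qed.

Lemma eisensteinM c e c' e' :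
  eisenstein c e * eisenstein c' e' =
  eisenstein ((c * c' - 3 * e * e') / 2) ((c * e' + e * c') / 2).
Proof. by rewrite mul_mx2; congr mx2; field. Qed.

Lemma det_eisenstein c e : c ^+ 2 - 4 = - 3 * e ^+ 2 ->
  \det (eisenstein c e) = 1.
Proof.
move=> E; have E2 : c ^+ 2 = -3 * e ^+ 2 + 4 by rewrite -E subrK.
by rewrite det_mx2; field: E2.
Qed.

Lemma eisenstein_quad c e : c ^+ 2 - 4 = - 3 * e ^+ 2 ->
  eisenstein c e ^+ 2 = c *: eisenstein c e - 1.
Proof.
move=> E; have E2 : c ^+ 2 = -3 * e ^+ 2 + 4 by rewrite -E subrK.
rewrite expr2 mul_mx2 mx2_1 scale_mx2 -scaleN1r scale_mx2 add_mx2.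
by congr mx2; field: E2.
Qed.

Lemma companion2_quad c : companion2 c ^+ 2 = c *: companion2 c - 1.
Proof.
rewrite expr2 mul_mx2 mx2_1 scale_mx2 -scaleN1r scale_mx2 add_mx2.
by congr mx2; ring.
Qed.

(** Let D be the companion matrix and L the Eisenstein one; both are killed by
    X^2 - c X + 1, so D^k = u D + v and L^k = u L + v with the same u, v.  If
    D^k = 1 then u = 0 and v = 1, so L^k = 1.  If L^k = 1 then u e = 0, which
    leaves D^k = 1 + u (D - c/2) with (D - c/2)^2 = c^2/4 - 1 = - 3 e^2 / 4; so
    D^k is unipotent and D^(k p) = 1.  The orders agree up to a factor p <> 3,
    including when e = 0, where they may differ. *)
Lemma logn3_order_companion2 c e : c ^+ 2 - 4 = - 3 * e ^+ 2 ->
  logn 3 #[gl (companion2 c)]%g = logn 3 #[gl (eisenstein c e)]%g.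
Proof.
move=> E; have E2 : c ^+ 2 = -3 * e ^+ 2 + 4 by rewrite -E subrK.
set D := companion2 c; set L := eisenstein c e.
have LdD : (#[gl L]%g %| #[gl D]%g)%N.
  rewrite dvdn_order_gl ?det_eisenstein //; set k := #[_]%g.
  have := dvdnn k; rewrite dvdn_order_gl ?det_companion2 // => /eqP.
  have [u [v uv]] := quadratic_pow 1 c k.
  rewrite (uv _ (companion2_quad c)) => E1; rewrite (uv _ (eisenstein_quad E)).
  rewrite mx2_1 !scale_mx2 add_mx2 !(mulr0, mulr1, add0r, addr0) in E1.
  by have [-> _ -> _] := mx2_inj E1; rewrite scale0r add0r scale1r.
have DdL : (#[gl D]%g %| #[gl L]%g * p)%N.
  rewrite dvdn_order_gl ?det_companion2 //; set k := #[_]%g.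
  have := dvdnn k; rewrite dvdn_order_gl ?det_eisenstein // => /eqP.
  have [u [v uv]] := quadratic_pow 1 c k.
  rewrite (uv _ (eisenstein_quad E)) exprM => E1.
  rewrite (uv _ (companion2_quad c)).
  rewrite mx2_1 !scale_mx2 add_mx2 in E1.
  have [] := mx2_inj E1; rewrite !(mulr0, mulr1, addr0) => h1 _ h2 _.
  (* N is u (D - c/2). *)
  pose N := u *: (mx2 (- c / 2) (-1) 1 (c / 2)).
  have ue : u * e = 0 by rewrite -(mul0r 2) -h2; field.
  have -> : u *: D + v *: 1 = N + 1.
    have -> : v = 1 - u * (c / 2).
      by apply/eqP; rewrite eq_sym subr_eq addrC h1.
    by rewrite mx2_1 /N !scale_mx2 !add_mx2; congr mx2; field.
  have N2 : N ^+ 2 = 0.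
    have h : u * u * (c ^+ 2 / 4 - 1) = 0.
      have c4 : c ^+ 2 / 4 - 1 = -3 / 4 * e ^+ 2 by field: E2.
      by rewrite c4 mulrCA -expr2 -exprMn ue expr0n mulr0.
    rewrite expr2 /N -scalerAr -scalerAl scalerA mul_mx2 scale_mx2.
    apply: etrans (esym (mx2_0 F)).
    by congr mx2; [rewrite -h| | |rewrite -h]; field; rewrite ?n4 n2.
  (* Additivity of Frobenius on the commuting pair 1, N. *)
  have pM : p \in [pchar 'M[F]_2] by rewrite pchar_lalg.
  have := pFrobenius_autD_comm pM (commr1 N).
  rewrite !pFrobenius_autE expr1n => ->.
  by rewrite -(subnK (ltnW (ltnW (ltnW p5)))) exprD N2 mulr0 add0r.
have np : (0 < #[gl L]%g * p)%N by rewrite muln_gt0 order_gt0; lia.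
apply: anti_leq; rewrite [X in _ && X]dvdn_leq_log // andbT.
apply: leq_trans (dvdn_leq_log 3 np DdL) _.
rewrite lognM ?order_gt0 //; last lia.
rewrite (logn_coprime (m := p)) ?addn0 // coprime_sym.
rewrite prime_coprime ?(pcharf_prime pF) //.
by rewrite gtnNdvd //; lia.
Qed.

(** (-1 - sqrt(-3)) / 2: of the two primitive cube roots of 1, the one for
    which lambda omega^i has trace a_i, in the indexing of the associate values. *)
Definition omega : 'M[F]_2 := eisenstein (-1) (-1).

(** Commuting with omega puts x in F[sqrt(-3)], say x = a + c sqrt(-3), and
    Cayley-Hamilton gives x^3 = (4 a^2 - 1) x - 2 a.  The coefficient of sqrt(-3)
    in x^3 = 1 is (4 a^2 - 1) c = 0, which leaves x = 1 or, using the norm,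
    x = (-1 +- sqrt(-3)) / 2.  F[sqrt(-3)] may fail to be a field, so the
    determinant condition cannot be dropped. *)
Lemma cube_root1 (x : 'M[F]_2) :
  x * omega = omega * x -> \det x = 1 -> x ^+ 3 = 1 ->
  exists i, x = omega ^+ i.
Proof.
rewrite [x]mx2_eta; move: (x 0 0) (x 0 1) (x 1 0) (x 1 1) => a b c d.
move=> + + x3; rewrite det_mx2 !mul_mx2 => /mx2_inj[E1 _ E3 _] dx.
have Eb : b = -3 * c.
  apply: (mulIf n2); transitivity (-4 * (b * (-1 / 2))); first by field.
  rewrite (_ : b * _ = (a * (-1 / 2) + b * (-1 / 2)) - a * (-1 / 2)).
    by rewrite E1; field.
  by ring.
have Ed : d = a.
  apply: (mulIf n2); transitivity (-4 * (d * (-1 / 2))); first by field.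
  rewrite (_ : d * _ = (c * (-1 / 2) + d * (-1 / 2)) - c * (-1 / 2)).
    by rewrite E3; field.
  by ring.
rewrite Eb Ed in dx x3 *.
rewrite (_ : mx2 _ _ _ _ = eisenstein (2 * a) (2 * c)) in x3 *; last first.
  by congr mx2; field.
have a2 : a * a = 1 - 3 * c * c.
  by apply: (addIr (3 * c * c)); rewrite subrK -[RHS]dx; ring.
have q : (2 * a) ^+ 2 - 4 = -3 * (2 * c) ^+ 2 by ring: a2.
have x3E : (4 * a ^+ 2 - 1) *: eisenstein (2 * a) (2 * c) - (2 * a)%:A = 1.
  apply: etrans x3; rewrite (exprSr _ 2) eisenstein_quad // mulrBl.
  rewrite -scalerAl mul1r -expr2 eisenstein_quad // scalerBr scalerA.
  by rewrite scalerBl scale1r addrAC; congr (_ *: _ - _ - _); ring.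
rewrite mx2_1 -scaleNr !scale_mx2 add_mx2 in x3E.
have [x00 _ x10 _] := mx2_inj x3E.
have /eqP : (4 * a ^+ 2 - 1) * c = 0 by rewrite -x10; field.
rewrite mulf_eq0 => /orP[a4|/eqP c0]; last first.
  have a1 : a = 1.
    rewrite -x00; transitivity ((4 * (a * a) - 3) * a); last by field.
    by rewrite a2 c0; ring.
  by exists 0%N; rewrite c0 a1 expr0 mx2_1; congr mx2; field.
have aE : a = -1 / 2.
  rewrite (eqP a4) mul0r add0r mulr1 in x00.
  by apply: (mulIf n2); rewrite divfK // -[in RHS]x00; ring.
have : (2 * c - 1) * (2 * c + 1) = 0.
  apply: (mulIf n3); rewrite mul0r; transitivity (4 * (1 - a * a) - 3).
    by rewrite a2; ring.
  by rewrite aE; field.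
move/eqP; rewrite mulf_eq0 subr_eq0 addr_eq0 => /orP[]/eqP->.
  by exists 2; rewrite expr2 eisensteinM aE; congr eisenstein; field.
by exists 1%N; rewrite expr1 aE; congr eisenstein; field.
Qed.

Lemma omega_sqr : omega ^+ 2 = eisenstein (-1) 1.
Proof. by rewrite expr2 eisensteinM; congr eisenstein; field. Qed.

Lemma det_omega : \det omega = 1.
Proof. by apply: det_eisenstein; ring. Qed.

Lemma order_omega : #[gl omega]%g = 3.
Proof.
apply: nt_prime_order => //; last first.
  apply/negP => /eqP /(congr1 val); rewrite glK ?det_omega // FinRing.val_unit1.
  rewrite mx2_1 => /mx2_inj[_ _ + _]; apply/eqP.
  by rewrite mulf_eq0 invr_eq0 (negPf n2) orbF oppr_eq0 oner_eq0.
apply/eqP; rewrite -order_dvdn dvdn_order_gl ?det_omega //.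
rewrite exprSr omega_sqr eisensteinM mx2_1.
by apply/eqP; congr mx2; field.
Qed.

Lemma cube_root_gl (u : {unit 'M[F]_2}) : commute u (gl omega) ->
  \det (val u) = 1 -> (u ^+ 3)%g = 1%g -> u \in <[gl omega]>%g.
Proof.
move=> cu du u3.
have [| | |i ui] := cube_root1 (x := val u).
- by move/(congr1 val): cu; rewrite !FinRing.val_unitM glK ?det_omega.
- exact: du.
- by move/(congr1 val): u3; rewrite FinRing.val_unitX FinRing.val_unit1.
have -> : u = (gl omega ^+ i)%g.
  by apply: val_inj; rewrite FinRing.val_unitX glK ?det_omega.
exact: mem_cycle.
Qed.

Lemma det_unitX (u : {unit 'M[F]_2}) k : \det (val u) = 1 ->
  \det (val (u ^+ k)%g) = 1.
Proof.
move=> du; elim: k => [|k IH]; first by rewrite expg0 FinRing.val_unit1 det1.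
by rewrite expgS FinRing.val_unitM det_mulmx du IH mulr1.
Qed.

(** The associate values over F: the traces of lambda omega^i, where
    lambda = (c + e sqrt(-3)) / 2. *)
Definition twist_trace (c e : F) (i : 'I_3) : F :=
  tnth [tuple c; (- c + 3 * e) / 2; (- c - 3 * e) / 2] i.

(** The coefficients e' of sqrt(-3) in 2 lambda omega^i are
    e, (- c - e) / 2 and (c - e) / 2. *)
Lemma eisenstein_twist c e (i : 'I_3) : c ^+ 2 - 4 = - 3 * e ^+ 2 ->
  exists2 e', twist_trace c e i ^+ 2 - 4 = - 3 * e' ^+ 2
    & gl (eisenstein (twist_trace c e i) e') =
      (gl (eisenstein c e) * gl omega ^+ i)%g.
Proof.
move=> E; have c2 : c ^+ 2 = -3 * e ^+ 2 + 4 by rewrite -E subrK.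
pose E' i := tnth [tuple e; (- c - e) / 2; (c - e) / 2] i.
have E'P : twist_trace c e i ^+ 2 - 4 = - 3 * E' i ^+ 2.
  by case: i => [[|[|[|//]]] hi]; rewrite /twist_trace /E' /tnth /=;
     field: c2; rewrite ?n4 ?n2.
exists (E' i) => //; apply: val_inj.
rewrite FinRing.val_unitM FinRing.val_unitX !glK ?det_omega ?det_eisenstein //.
case: i {E'P} => [[|[|[|//]]] hi]; rewrite /twist_trace /E' /tnth /=.
- by rewrite expr0 mulr1.
- by rewrite expr1 eisensteinM; congr eisenstein; field.
- by rewrite omega_sqr eisensteinM; congr eisenstein; field.
Qed.

Lemma twist_trichotomy c e : c ^+ 2 - 4 = - 3 * e ^+ 2 ->
  let v i := logn 3 #[gl (companion2 (twist_trace c e i))]%g in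
  [/\ forall i j : 'I_3, i != j -> v i = 0%N -> v j = 1%N,
      forall i, v i = 1%N -> exists j, v j = 0%N
    & forall i j, (1 < v i)%N -> v j = v i].
Proof.
move=> E v; pose g := gl (eisenstein c e); pose w := gl omega.
have vE i : v i = logn 3 #[g * w ^+ i]%g.
  have [e' E' <-] := eisenstein_twist i E; exact: logn3_order_companion2.
have ow : #[w]%g = 3 := order_omega.
have cgw : commute g w.
  apply: val_inj; rewrite !FinRing.val_unitM !glK ?det_omega ?det_eisenstein //.
  by rewrite !eisensteinM; congr eisenstein; ring.
split=> [i j ij|i|i j]; rewrite !vE; last exact: (logn3_twist2 cgw ow).
  by move/(logn3_twist0 cgw ow); apply; rewrite !modn_small.
case/(logn3_twist1 cgw ow) => [k k3|j vj].
  apply: cube_root_gl k3; last first.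
    apply: det_unitX; have [e' E' <-] := eisenstein_twist i E.
    by rewrite glK det_eisenstein.
  apply/commute_sym/commuteX/commute_sym.
  by have := twist_commute cgw i 1; rewrite expg1.
exists (inord (j %% 3)); rewrite vE inordK ?ltn_pmod //.
by move: vj; rewrite -(expg_mod_order w) ow.
Qed.
End Field.

(** * Reduction modulo p of p-integral rationals *)

Lemma prime_numq_denq p x : prime p ->
  (p %| `|numq x|)%N -> (p %| `|denq x|)%N -> False.
Proof.
move=> pp pn pd; have := dvdn_gcd p `|numq x| `|denq x|.
by rewrite pn pd (eqP (coprime_num_den x)) dvdn1; case: eqP pp => // ->.
Qed.

Section Reduction.
Variable (p : nat).
Hypothesis pp : prime p.

(** A relation rather than a function, so that any fraction with denominator
    prime to p computes the residue; [reduces_den] and [reduces_num] link it to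
    the fraction in lowest terms. *)
Definition reduces (x : rat) (c : 'F_p) : Prop :=
  exists n d : int, [/\ (d%:~R : 'F_p) != 0, x * d%:~R = n%:~R
                      & c = n%:~R / d%:~R].

Lemma reducesD x y c e : reduces x c -> reduces y e -> reduces (x + y) (c + e).
Proof.
move=> [n [d [d0 xd ->]]] [m [f [f0 yf ->]]].
exists (n * f + m * d), (d * f); rewrite rmorphM rmorphD !rmorphM /=; split.
- by rewrite mulf_neq0.
- by rewrite -xd -yf; ring.
- by field; rewrite f0 d0.
Qed.

Lemma reducesM x y c e : reduces x c -> reduces y e -> reduces (x * y) (c * e).
Proof.
move=> [n [d [d0 xd ->]]] [m [f [f0 yf ->]]].
exists (n * m), (d * f); rewrite !rmorphM /=; split.
- by rewrite mulf_neq0.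
- by rewrite -xd -yf; ring.
- by field; rewrite f0 d0.
Qed.

Lemma reduces_int (n : int) : reduces n%:~R n%:~R.
Proof. by exists n, 1; rewrite oner_neq0 mulr1 divr1. Qed.

Lemma reducesN x c : reduces x c -> reduces (- x) (- c).
Proof. by rewrite -mulN1r -[- c]mulN1r => /(reducesM (reduces_int (-1))). Qed.

Lemma reduces_half : (2 < p)%N -> reduces 2^-1 2^-1.
Proof.
move=> p2; exists 1, 2; split; rewrite ?mulVf ?mul1r //.
by rewrite intF_eq0 // gtnNdvd.
Qed.

Lemma reduces_den x : ~~ (p %| `|denq x|)%N <-> exists c, reduces x c.
Proof.
split=> [pd|[_ [n [d [d0 xd _]]]]].
  exists ((numq x)%:~R / (denq x)%:~R), (numq x), (denq x).
  by rewrite intF_eq0 // -numqE.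
have E : numq x * d = n * denq x.
  by apply/eqP; rewrite -(eqr_int rat) !intrM numqE -xd mulrAC.
apply/negP => pd.
have /eqP : (numq x * d)%:~R = 0 :> 'F_p.
  by apply/eqP; rewrite E intF_eq0 // abszM dvdn_mull.
rewrite rmorphM mulf_eq0 (negPf d0) orbF intF_eq0 // => pn.
exact: prime_numq_denq pn pd.
Qed.

Lemma reduces_num x c : reduces x c -> (p %| `|numq x|)%N = (c == 0).
Proof.
move=> [n [d [d0 xd ->]]].
have dx : ((denq x)%:~R : 'F_p) != 0.
  rewrite intF_eq0 //; apply/(reduces_den x).
  by exists (n%:~R / d%:~R), n, d.
have E : numq x * d = n * denq x.
  by apply/eqP; rewrite -(eqr_int rat) !intrM numqE -xd mulrAC.
rewrite mulf_eq0 invr_eq0 (negPf d0) orbF -intF_eq0 //.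
have /(congr1 (fun m : int => m%:~R : 'F_p)) := E; rewrite !rmorphM /= => E'.
apply/eqP/eqP => z; rewrite z mul0r in E'.
  by move/esym/eqP: E'; rewrite mulf_eq0 (negPf dx) orbF => /eqP.
by move/eqP: E'; rewrite mulf_eq0 (negPf d0) orbF => /eqP.
Qed.

Lemma mxcongr_reduces (M : 'M[rat]_2) (N : 'M['F_p]_2) :
  (forall i j, reduces (M i j) (N i j)) -> mxcongr p M 1 = (N == 1).
Proof.
move=> MN.
have E i j :
    (p %| `|numq (M i j - (1 : 'M_2) i j)|)%N = (N i j == (1 : 'M_2) i j).
  rewrite -subr_eq0; apply: reduces_num; apply: reducesD => //; apply: reducesN.
  rewrite !mxE.
  by case: (i == j); [exact: (reduces_int 1) | exact: (reduces_int 0)].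
apply/forallP/eqP => [h|N1 i].
  by apply/matrixP => i j; apply/eqP; rewrite -E; move/forallP: (h i); apply.
by apply/forallP => j; rewrite E N1.
Qed.
End Reduction.

(** * The index as the order of a matrix over F_p *)

Section Index.
Variable (p : nat).
Hypotheses (pp : prime p) (p5 : (5 <= p)%N).

Let pF : p \in [pchar 'F_p] := pchar_Fp pp.

Lemma reduces_Dmx_pow a c k i j : reduces a c ->
  reduces ((Dmx a ^+ k) i j) ((companion2 (F := 'F_p) c ^+ k) i j).
Proof.
move=> ac; elim: k i j => [|k IH] i j.
  rewrite !expr0 !mxE.
  by case: (i == j); [exact: (reduces_int _ 1) | exact: (reduces_int _ 0)].
rewrite !exprSr !mxE !big_ord_recl !big_ord0 !addr0.
apply: reducesD => //; apply: reducesM => //; rewrite !mxE.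
  case: j => [[|[|//]] ?] /=; first exact: (reduces_int _ 0).
  exact: (reduces_int _ (-1)).
by case: j => [[|[|//]] ?] /=; [exact: (reduces_int _ 1) |].
Qed.

Lemma in_Pi_reduces a : in_Pi a p <-> exists c : 'F_p, reduces a c.
Proof. by rewrite /in_Pi pp p5; exact: reduces_den. Qed.

Lemma chi_order a c : reduces a c ->
  chi a p = #[gl (companion2 (F := 'F_p) c)]%g.
Proof.
move=> ac; rewrite /chi; case: ex_minnP => m.
have -> : in_Pi a p by apply/in_Pi_reduces; exists c.
have cE k : mxcongr p (Dmx a ^+ k) 1 =
    (#[gl (companion2 (F := 'F_p) c)]%g %| k)%N.
  rewrite dvdn_order_gl ?det_companion2 //; apply: mxcongr_reduces => // i j.
  exact: reduces_Dmx_pow.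
rewrite implyTb cE => /andP[m0 dm] min; apply/eqP.
by rewrite eqn_leq min ?cE ?order_gt0 ?dvdnn // dvdn_leq.
Qed.

(** As 3 is invertible modulo p, b^2 = (4 - t^2) / 3 is p-integral, hence so
    is b. *)
Lemma reduces_cubic t b c : t ^+ 2 - 4 = -3 * b ^+ 2 -> reduces t c ->
  exists2 e : 'F_p, reduces b e & c ^+ 2 - 4 = - 3 * e ^+ 2.
Proof.
move=> E tc.
have b2 : reduces (3 * b ^+ 2) (4 - c ^+ 2).
  have -> : 3 * b ^+ 2 = 4 - t ^+ 2 by rewrite -opprB E mulNr opprK.
  by apply: reducesD; [exact: (reduces_int _ 4) | apply/reducesN/reducesM].
have [e be] : exists e : 'F_p, reduces b e.
  apply/reduces_den => //; apply/negP => pd.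
  have [n [d [d0 bd _]]] := b2.
  have Ez : 3 * numq b ^+ 2 * d = n * denq b ^+ 2.
    apply/eqP; rewrite -(eqr_int rat) !rmorphM /= numqE -bd; apply/eqP.
    by ring.
  have /eqP : (3 * numq b ^+ 2 * d)%:~R = 0 :> 'F_p.
    by apply/eqP; rewrite Ez intF_eq0 // abszM abszX dvdn_mull // dvdn_exp.
  have n3 := small_neq0 pF p5 (n := 3) isT.
  rewrite !rmorphM /= !mulf_eq0 (negPf d0) (negPf n3) orbF /= orbb.
  rewrite intF_eq0 // => pn.
  exact: prime_numq_denq pn pd.
exists e => //.
have e2 : reduces (3 * b ^+ 2 - 3 * b ^+ 2) (4 - c ^+ 2 - 3 * e ^+ 2).
  apply: reducesD => //; apply/reducesN/reducesM; last exact: reducesM.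
  exact: (reduces_int _ 3).
have /eqP z : 4 - c ^+ 2 - 3 * e ^+ 2 == 0.
  by rewrite -(reduces_num pp e2) subrr; exact: dvdn0.
by apply/eqP; rewrite -subr_eq0 -oppr_eq0 -z; apply/eqP; ring.
Qed.

Lemma reduces_comb t b c e (k l : int) : reduces t c -> reduces b e ->
  reduces (p := p) ((k%:~R * t + l%:~R * b) / 2) ((k%:~R * c + l%:~R * e) / 2).
Proof.
move=> tc be; apply: reducesM; last by apply: reduces_half => //; lia.
by apply: reducesD; apply: reducesM => //; exact: reduces_int.
Qed.

Lemma in_Pi_comb t b (k l : int) : t ^+ 2 - 4 = -3 * b ^+ 2 -> in_Pi t p ->
  in_Pi ((k%:~R * t + l%:~R * b) / 2) p.
Proof.
move=> E /in_Pi_reduces[c tc]; have [e be _] := reduces_cubic E tc.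
by apply/in_Pi_reduces; eexists; exact: (reduces_comb k l tc be).
Qed.

Lemma chi_trichotomy t b : t ^+ 2 - 4 = -3 * b ^+ 2 -> in_Pi t p ->
  let v (i : 'I_3) := logn 3 (chi (tnth (associates t b) i) p) in
  [/\ forall i j : 'I_3, i != j -> v i = 0%N -> v j = 1%N,
      forall i, v i = 1%N -> exists j, v j = 0%N
    & forall i j, (1 < v i)%N -> v j = v i].
Proof.
move=> E /in_Pi_reduces[c tc] v; have [e be Ec] := reduces_cubic E tc.
suff vE i : v i = logn 3 #[gl (companion2 (twist_trace c e i))]%g.
  have [v01 v10 v2] := twist_trichotomy pF p5 Ec.
  split=> [i j ij|i|i j]; rewrite !vE; [exact: v01 | | exact: v2].
  by case/v10=> j vj; exists j; rewrite vE.
congr (logn 3 _); apply: chi_order.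
case: i => [[|[|[|//]]] hi]; rewrite /tnth /=; first exact: tc.
- by have := reduces_comb (-1) 3 tc be; rewrite !mulN1r.
- by have := reduces_comb (-1) (-3) tc be; rewrite !mulN1r !mulNr.
Qed.
End Index.

(** * The three associate values together *)

Lemma mem_Pi j a p : Pi_ j a p <-> in_Pi a p /\ logn 3 (chi a p) = j.
Proof.
rewrite /Pi_ /=; split=> [/and3P[ap d nd]|[ap vj]].
  split=> //; have c0 : (0 < chi a p)%N.
    by rewrite lt0n; apply: contraNneq nd => ->; rewrite dvdn0.
  apply/eqP; rewrite eqn_leq -pfactor_dvdn // d andbT leqNgt -pfactor_dvdn //.
have c0 : (0 < chi a p)%N.
  by rewrite /chi; case: ex_minnP => m; rewrite ap => /andP[].
by rewrite ap !pfactor_dvdn // vj leqnn ltnn.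
Qed.

(** Each associate value is (k t + l b) / 2 with integers k, l, so it is
    p-integral when t is.  Conversely a_i is itself cubic, with b_i in the role of
    b, and t is an integral combination of a_i and b_i divided by 2. *)
Lemma in_Pi_associates t b p (i : 'I_3) : t ^+ 2 - 4 = -3 * b ^+ 2 ->
  in_Pi (tnth (associates t b) i) p = in_Pi t p.
Proof.
move=> E; have [[pp p5]|np] := pselect (prime p /\ (5 <= p)%N); last first.
  by rewrite /in_Pi; case: (prime p) np => //; case: (5 <= p)%N => // -[].
have b2 : t ^+ 2 = -3 * b ^+ 2 + 4 by rewrite -E subrK.
case: i => [[|[|[|//]]] hi]; rewrite /tnth /=; first by [].
- apply/idP/idP => [|/(in_Pi_comb pp p5 (-1) 3 E)]; last by rewrite mulN1r.
  have E1 : ((- t + 3 * b) / 2) ^+ 2 - 4 = -3 * ((- t - b) / 2) ^+ 2.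
    by field: b2.
  by move/(in_Pi_comb pp p5 (-1) (-3) E1); congr in_Pi; field.
- apply/idP/idP => [|/(in_Pi_comb pp p5 (-1) (-3) E)]; last first.
    by rewrite mulN1r mulNr.
  have E1 : ((- t - 3 * b) / 2) ^+ 2 - 4 = -3 * ((t - b) / 2) ^+ 2 by field: b2.
  by move/(in_Pi_comb pp p5 (-1) 3 E1); congr in_Pi; field.
Qed.

Local Open Scope classical_set_scope.

Theorem proposition14 (t b : rat)
  (ht0 : t != 0) (ht1 : t != 1) (htN1 : t != -1) (ht2 : t != 2) (htN2 : t != -2)
  (hb : b != 0) (hcubic : t ^+ 2 - 4 = -3 * b ^+ 2) :
  let a := tnth (associates t b) in
  [/\ forall i k : 'I_3, i != k -> Pi_ 0 (a i) `&` Pi_ 0 (a k) = set0,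
      forall k1 k2 k3 : 'I_3, k1 != k2 -> k1 != k3 -> k2 != k3 ->
        Pi_ 1 (a k1) = Pi_ 0 (a k2) `|` Pi_ 0 (a k3)
    & forall j : nat, (2 <= j)%N ->
        Pi_ j (a 0) = Pi_ j (a 1) /\ Pi_ j (a 1) = Pi_ j (a 2)].
Proof.
move=> a.
have PiE j i p : Pi_ j (a i) p <-> in_Pi t p /\ logn 3 (chi (a i) p) = j.
  by rewrite mem_Pi in_Pi_associates.
have twist p : in_Pi t p -> _ := fun tp =>
  let: And3 pp p5 _ := and3P tp in chi_trichotomy pp p5 hcubic tp.
split.
- move=> i k ik; apply/seteqP; split=> // p [/PiE[tp vi] /PiE[_ vk]].
  by have [v0 _ _] := twist p tp; rewrite (v0 i k ik vi) in vk.
- move=> k1 k2 k3 k12 k13 k23; apply/seteqP; split=> p.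
    move/PiE=> [tp v1]; have [_ /(_ k1 v1)[j vj] _] := twist p tp.
    have jk : j != k1 by apply: contra_eq_neq v1 => <-; rewrite vj.
    have [<-|j2] := eqVneq j k2; first by left; apply/PiE.
    suff <- : j = k3 by right; apply/PiE.
    apply: val_inj; move: k12 k13 k23 jk j2; rewrite -!val_eqE /=.
    by case: k1 k2 k3 j {v1 vj} => [? ?] [? ?] [? ?] [? ?] /=; lia.
  case=> /PiE[tp v0]; have [v01 _ _] := twist p tp; apply/PiE; split=> //.
    by apply: v01 v0; rewrite eq_sym.
  by apply: v01 v0; rewrite eq_sym.
- move=> j j2; have sub i k p : Pi_ j (a i) p -> Pi_ j (a k) p.
    case/PiE=> tp vj; apply/PiE; split=> //.
    by have [_ _ vv] := twist p tp; rewrite -vj; apply: vv; rewrite vj.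
  by split; apply/seteqP; split=> p; apply: sub.
Qed.
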